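(* Let $f\in\mathcal{A}$, and let $\beta,\gamma,\delta$ be real numbers with $\gamma\geq 0$ and $\delta>-\frac{1}{2}$. If $$\left|f'(z)-1\right|^{\beta}\left|\delta+\frac{zf''(z)}{f'(z)}\right|^{\gamma}<\left(\frac{1+2\delta}{2}\right)^{\gamma}\qquad\text{for all } z\in\mathbb{U},$$ then $f\in\mathcal{C}$, i.e. $|f'(z)-1|<1$ for all $z\in\mathbb{U}$.
   Context: $\mathbb{U}=\{z\in\mathbb{C}:|z|<1\}$ is the open unit disk. $\mathcal{A}$ is the class of functions $f$ analytic in $\mathbb{U}$ with $f(0)=0$ and $f'(0)=1$. $\mathcal{C}=\{f\in\mathcal{A}: |f'(z)-1|<1 \text{ for all } z\in\mathbb{U}\}$. *)

(* Defs.v *)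
From HB Require Import structures.
From mathcomp Require Import all_boot all_order all_algebra.
From mathcomp Require Import complex.
From mathcomp Require Import all_classical all_reals all_analysis.

Set Implicit Arguments.
Unset Strict Implicit.
Unset Printing Implicit Defensive.

Import Order.TTheory GRing.Theory Num.Theory.
Import numFieldNormedType.Exports.

Local Open Scope complex_scope.
Local Open Scope ring_scope.
Local Open Scope classical_set_scope.

(* The topology of the complex plane is the one carried by the regular module
   R[i]^o over the numFieldType R[i]; derive1 is therefore the complex
   derivative.  The norm `|z| and the order on R[i] take values in R[i]
   (x < y forces x and y to have the same imaginary part), so `|z| < 1 is the
   usual inequality between real numbers. *)

Definition unit_disk (R : realType) : set R[i]^o := [set z | `|z| < 1].

Definition analytic_at (R : realType) (f : R[i]^o -> R[i]^o) (a : R[i]^o) :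
    Prop :=
  exists c : nat -> R[i]^o, \forall z \near a,
    series (fun n => c n * (z - a) ^+ n) @ \oo --> f z.

(* Functions on the disk are represented by total functions; analyticity on an
   open set D and derivatives at points of D only depend on the values on D. *)
Definition analytic_on (R : realType) (D : set R[i]^o)
    (f : R[i]^o -> R[i]^o) : Prop :=
  forall a, D a -> analytic_at f a.

Definition classA (R : realType) (f : R[i]^o -> R[i]^o) : Prop :=
  [/\ analytic_on (@unit_disk R) f, f 0 = 0 & derive1 f 0 = 1].

Definition classC (R : realType) (f : R[i]^o -> R[i]^o) : Prop :=
  classA f /\ forall z, unit_disk z -> `|derive1 f z - 1| < 1.

(* The modulus as an element of R: `|z| = (modulus z)%:C.  It serves as the
   base of the real powers a `^ x, for which 0 `^ 0 = 1 and 0 `^ x = 0 for every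
   x != 0, including x < 0.  Likewise w / 0 = 0 in R[i].  In a hypothesis
   E < C with C > 0, where E has a factor |w|^beta and beta < 0, the inequality
   thus holds automatically where w = 0: such points impose no condition. *)
Definition modulus (R : realType) (z : R[i]) : R := Normc.normc z.

(* Main.v *)
(* Put g = f' - 1 and suppose |g| >= 1 somewhere in the disk.  Let z0 be a point of least
   modulus with |g z0| >= 1; then |g z0| = 1 and |g| <= 1 on |z| <= |z0|.  Schwarz' lemma gives
   |g z| <= |z| / |z0| there, and comparing first-order expansions along
   z = z0 (1 - t (1 + i s)), t -> 0+, for every real s yields Jack's lemma:
   z0 g'(z0) = k g(z0) with k >= 1.  If g z0 <> -1, then Re (g z0 / (1 + g z0)) = 1/2, so
   |delta + z0 f''(z0) / f'(z0)| >= delta + k / 2 contradicts the hypothesis at z0.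
   If g z0 = -1, then f''/f' has a pole at z0 and (for gamma > 0) the hypothesis fails at
   nearby points, because |g| is close to 1 there.

   Schwarz' lemma comes from the local maximum principle applied to g z / z at a point of
   largest modulus among its maximizers: local constancy there contradicts that choice. *)
Require Import Defs.
From mathcomp Require Import all_boot all_order all_algebra.
From mathcomp Require Import complex.
From mathcomp Require Import all_classical all_reals all_analysis.
From mathcomp Require Import ring lra zify.
Import Order.TTheory GRing.Theory Num.Theory.
Import numFieldNormedType.Exports.
Local Open Scope complex_scope.
Local Open Scope ring_scope.

Section Jack.
Context {R : realType}.
Local Notation C := R[i].
Implicit Types (z w a h k : C) (f g : C -> C).

Local Notation "⟦ z ⟧" := (modulus z) (format "⟦ z ⟧").

(** * Modulus and neighbourhoods in the complex plane *)

Lemma normC_modulus z : `|z| = ⟦z⟧%:C.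
Proof. by []. Qed.

Lemma modulus_ge0 z : 0 <= ⟦z⟧.
Proof. by rewrite -lecR -normC_modulus; exact: normr_ge0. Qed.

Lemma modulus0 : ⟦0 : C⟧ = 0.
Proof. exact: Normc.normc0. Qed.

Lemma modulus1 : ⟦1 : C⟧ = 1.
Proof. exact: Normc.normc1. Qed.

Lemma modulus_eq0 z : (⟦z⟧ == 0) = (z == 0).
Proof.
by apply/eqP/eqP => [/Normc.eq0_normc//|->]; exact: modulus0.
Qed.

Lemma modulus_gt0 z : (0 < ⟦z⟧) = (z != 0).
Proof. by rewrite lt_def modulus_ge0 andbT modulus_eq0. Qed.

Lemma modulusM z w : ⟦z * w⟧ = ⟦z⟧ * ⟦w⟧.
Proof. exact: Normc.normcM. Qed.

Lemma modulusV z : ⟦z^-1⟧ = ⟦z⟧^-1.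
Proof. exact: Normc.normcV. Qed.

Lemma modulusN z : ⟦- z⟧ = ⟦z⟧.
Proof. exact: normcN. Qed.

Lemma modulusD z w : ⟦z + w⟧ <= ⟦z⟧ + ⟦w⟧.
Proof. exact: le_normcD. Qed.

Lemma modulusB z w : ⟦z - w⟧ <= ⟦z⟧ + ⟦w⟧.
Proof. by rewrite -(modulusN w) modulusD. Qed.

Lemma modulusX z n : ⟦z ^+ n⟧ = ⟦z⟧ ^+ n.
Proof. by elim: n => [|n IH]; rewrite ?modulus1// !exprS modulusM IH. Qed.

Lemma modulus_real (x : R) : ⟦x%:C⟧ = `|x|.
Proof. by apply: (@complexI R); rewrite -normC_modulus normc_def /= expr0n addr0 sqrtr_sqr. Qed.

Lemma modulus_sum n (F : nat -> C) :
  ⟦\sum_(i < n) F i⟧ <= \sum_(i < n) ⟦F i⟧.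
Proof.
elim: n => [|n IH]; first by rewrite !big_ord0 modulus0.
rewrite !big_ord_recr /=; apply: le_trans (modulusD _ _) _.
by rewrite lerD2r.
Qed.

Lemma modulus_sqr z : ⟦z⟧ ^+ 2 = complex.Re z ^+ 2 + complex.Im z ^+ 2.
Proof.
by have := add_Re2_Im2 z; rewrite normC_modulus -rmorphXn => /complexI.
Qed.

Lemma Re_le_modulus z : complex.Re z <= ⟦z⟧.
Proof.
apply: le_trans (ler_norm _) _.
by rewrite -lecR -normC_modulus normc_ge_Re.
Qed.

(** A positive element of [R[i]] is real, so the radius of a ball, a priori complex, can be replaced
    by its real part. Later estimates can thus stay in [R]. *)
Lemma nearC_modulusP (a : R[i]^o) (P : set R[i]^o) :
  (\forall z \near a, P z) <->
  exists e : R, 0 < e /\ forall z, ⟦z - a⟧ < e -> P z.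
Proof.
split.
  move=> /nbhs_ballP[e /= e0 eP]; exists (complex.Re e).
  have eE : e = (complex.Re e)%:C by rewrite RRe_real// ger0_real// ltW.
  split; first by rewrite -ltcR -eE.
  move=> z za; apply: eP; rewrite -ball_normE /ball_ /= distrC eE normC_modulus ltcR.
  exact: za.
move=> [e [e0 eP]]; apply/nbhs_ballP; exists (e%:C) => /=; first by rewrite ltcR.
move=> z; rewrite -ball_normE /ball_ /= distrC normC_modulus ltcR; exact: eP.
Qed.

Lemma cvgC_modulus (u : nat -> R[i]^o) (l : R[i]^o) : (u @ \oo --> l)%classic ->
  forall e : R, 0 < e -> exists N, forall n, (N <= n)%N -> ⟦u n - l⟧ < e.
Proof.
move=> /cvgrPdist_lt ul e e0.
have /ul [N _ NP] : 0 < e%:C by rewrite ltcR.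
exists N => n Nn; rewrite -ltcR -normC_modulus distrC; exact: NP.
Qed.

(** * Differentiability with quadratic error *)

(* Complex differentiability with a quadratic error term, which every analytic function has. *)
Definition qdiff g a (d : C) := exists B e : R, [/\ 0 <= B, 0 < e &
  forall h, ⟦h⟧ < e -> ⟦g (a + h) - g a - d * h⟧ <= B * ⟦h⟧ ^+ 2].

Lemma derive1_qdiff (f : R[i]^o -> R[i]^o) (a : R[i]^o) d : qdiff f a d -> derive1 f a = d.
Proof.
move=> [B [e [B0 e0 gP]]].
rewrite /derive1; apply: cvg_lim => //.
apply/cvgrPdist_lt => eps eps0.
have epsE : eps = (complex.Re eps)%:C by rewrite RRe_real// ger0_real// ltW.
have r0 : 0 < complex.Re eps by rewrite -ltcR -epsE.
rewrite near_withinE.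
apply/nearC_modulusP; exists (Num.min e (complex.Re eps / (B + 1))); split.
  by rewrite lt_min e0 divr_gt0// ltr_wpDl.
move=> h; rewrite subr0 lt_min => /andP[he]; rewrite ltr_pdivlMr ?ltr_wpDl// => hr h0.
have hp : 0 < ⟦h⟧ by rewrite modulus_gt0.
rewrite epsE normC_modulus ltcR.
have -> : d - h^-1 *: ((f (h + a) - f a) : R[i]^o) = - (f (a + h) - f a - d * h) / h :> R[i].
  rewrite [h + a]addrC /GRing.scale /=.
  have E (x : C) : d - h^-1 * x = - (x - d * h) / h by field; exact: h0.
  exact: E.
rewrite modulusM modulusN modulusV ltr_pdivrMr//.
apply: le_lt_trans (gP _ he) _.
rewrite expr2 mulrA ltr_pM2r//.
nra.
Qed.

Lemma qdiffD f g a d e : qdiff f a d -> qdiff g a e ->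
  qdiff (fun z => f z + g z) a (d + e).
Proof.
move=> [B [r [B0 r0 fP]]] [B' [r' [B'0 r'0 gP]]].
exists (B + B'), (Num.min r r'); split; rewrite ?addr_ge0 ?lt_min ?r0//.
move=> h; rewrite lt_min => /andP[hr hr'].
have -> : f (a + h) + g (a + h) - (f a + g a) - (d + e) * h =
  (f (a + h) - f a - d * h) + (g (a + h) - g a - e * h) by ring.
apply: le_trans (modulusD _ _) _; rewrite mulrDl.
by apply: lerD; [exact: fP|exact: gP].
Qed.

Lemma qdiffZ f a d (c : C) : qdiff f a d -> qdiff (fun z => c * f z) a (c * d).
Proof.
move=> [B [r [B0 r0 fP]]]; exists (⟦c⟧ * B), r; split=> //.
  by rewrite mulr_ge0 ?modulus_ge0.
move=> h hr.
have -> : c * f (a + h) - c * f a - c * d * h = c * (f (a + h) - f a - d * h).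
  by ring.
by rewrite modulusM -[leRHS]mulrA ler_wpM2l ?modulus_ge0 ?fP.
Qed.

Lemma qdiff_sum (F : nat -> C -> C) (D : nat -> C) a n :
  (forall i, qdiff (F i) a (D i)) ->
  qdiff (fun z => \sum_(i < n) F i z) a (\sum_(i < n) D i).
Proof.
move=> FD; elim: n => [|n [B [r [B0 r0 IH]]]].
  exists 0, 1; split=> // h _.
  by rewrite !big_ord0 mul0r !subr0 modulus0 mul0r.
have [B' [r' [B'0 r'0 P]]] : qdiff (fun z => \sum_(i < n) F i z + F n z) a
    (\sum_(i < n) D i + D n) by apply: qdiffD => //; exists B, r.
by exists B', r'; split=> // h hr; rewrite !big_ord_recr; exact: P.
Qed.

Lemma qdiffX a n : qdiff (fun z => z ^+ n) a (n%:R * a ^+ n.-1).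
Proof.
elim: n => [|n [B [r [B0 r0 IH]]]].
  exists 0, 1; split=> // h _.
  by rewrite !expr0 subrr !mul0r subrr modulus0.
exists ((⟦a⟧ + 1) * B + ⟦n%:R * a ^+ n.-1⟧), (Num.min r 1); split.
- by rewrite addr_ge0 ?mulr_ge0 ?addr_ge0 ?modulus_ge0.
- by rewrite lt_min r0 ltr01.
move=> h; rewrite lt_min => /andP[hr h1].
(* Product rule for [(a + h) * (a + h) ^+ n]. The restriction [⟦h⟧ < 1] serves to bound [⟦a + h⟧] by
   [⟦a⟧ + 1]. *)
have -> : (a + h) ^+ n.+1 - a ^+ n.+1 - n.+1%:R * a ^+ n.+1.-1 * h =
    (a + h) * ((a + h) ^+ n - a ^+ n - n%:R * a ^+ n.-1 * h) +
    (n%:R * a ^+ n.-1) * h ^+ 2.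
  rewrite /= -(natr1 n) !exprS; case: n {IH} => [|n] /=; rewrite ?exprS; ring.
apply: le_trans (modulusD _ _) _; rewrite [leRHS]mulrDl; apply: lerD.
  rewrite modulusM -[leRHS]mulrA; apply: ler_pM; rewrite ?modulus_ge0 ?IH//.
  by apply: le_trans (modulusD _ _) _; rewrite lerD2l ltW.
by rewrite modulusM modulusX.
Qed.

Lemma qdiff_shift f a b d : qdiff f (a + b) d -> qdiff (fun z => f (a + z)) b d.
Proof.
move=> [B [r [B0 r0 fP]]]; exists B, r; split=> // h hr.
by rewrite addrA; exact: fP.
Qed.

Lemma qdiff_inj f a d e : qdiff f a d -> qdiff f a e -> d = e.
Proof. by move=> fd fe; rewrite -(derive1_qdiff _ _ _ fd) (derive1_qdiff _ _ _ fe). Qed.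

(** Along real increments tending to 0 the quadratic error disappears against the linear terms. This
    turns Lipschitz estimates of remainders into estimates of derivatives. *)
Lemma qdiff_lipschitz g a d (L r : R) : qdiff g a d -> 0 < r ->
  (forall h, ⟦h⟧ < r -> ⟦g (a + h) - g a⟧ <= L * ⟦h⟧) -> ⟦d⟧ <= L.
Proof.
move=> [B [s [B0 s0 gP]]] r0 Lip; apply/ler_addgt0Pr => e e0.
pose t := Num.min (Num.min r s) (e / (B + 1)) / 2.
have B1 : 0 < B + 1 by rewrite ltr_wpDl.
have m0 : 0 < Num.min (Num.min r s) (e / (B + 1)).
  by rewrite !lt_min r0 s0 divr_gt0.
have t0 : 0 < t by rewrite divr_gt0.
have : t < Num.min (Num.min r s) (e / (B + 1)) by rewrite /t; lra.
rewrite !lt_min ltr_pdivlMr// => /andP[/andP[tr ts] te].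
have tE : ⟦t%:C⟧ = t by rewrite modulus_real gtr0_norm.
have H1 := Lip t%:C; have H2 := gP t%:C; rewrite tE in H1 H2.
have {}H1 := H1 tr; have {}H2 := H2 ts.
have : ⟦d * t%:C⟧ <= L * t + B * t ^+ 2.
  have -> : d * t%:C =
    (g (a + t%:C) - g a) - (g (a + t%:C) - g a - d * t%:C) by ring.
  by apply: le_trans (modulusB _ _) _; apply: lerD.
have -> : L * t + B * t ^+ 2 = (L + B * t) * t by ring.
rewrite modulusM tE ler_pM2r// => /le_trans; apply.
by rewrite lerD2l; nra.
Qed.

(** * Local Taylor expansions *)

(* Analyticity phrased with partial sums only, so that no infinite sum (hence no completeness
   of [C]) is ever needed; restricting to [1 < N] lets affine changes of [f] preserve [M]. *)
Definition taylor f a (c : nat -> C) (M rho : R) := [/\ 0 <= M, 0 < rho &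
  forall N h, (1 < N)%N -> ⟦h⟧ < rho ->
    ⟦f (a + h) - \sum_(n < N) c n * h ^+ n⟧ <= M * (⟦h⟧ / rho) ^+ N].

Lemma sum_pow0 (c : nat -> C) n : \sum_(i < n.+1) c i * 0 ^+ i = c 0%N.
Proof.
rewrite big_ord_recl expr0 mulr1 big1 ?addr0// => i _.
by rewrite /= exprS mul0r mulr0.
Qed.

Lemma taylor0 f a c M rho : taylor f a c M rho -> c 0%N = f a.
Proof.
move=> [M0 r0 /(_ 2%N 0 isT)].
rewrite modulus0 sum_pow0 mul0r expr0n mulr0 addr0 => /(_ r0) H.
apply/esym/eqP; rewrite -subr_eq0 -modulus_eq0; apply/eqP/le_anti.
by rewrite H modulus_ge0.
Qed.

Lemma taylor_shrink f a c M rho r : taylor f a c M rho -> 0 < r -> r <= rho ->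
  taylor f a c M r.
Proof.
move=> [M0 r0 fP] rp rr; split=> // N h N1 hr.
apply: le_trans (fP N h N1 (lt_le_trans hr rr)) _.
rewrite ler_wpM2l// lerXn2r ?nnegrE ?divr_ge0 ?modulus_ge0 ?(ltW rp) ?(ltW r0)//.
by rewrite ler_wpM2l ?modulus_ge0// lef_pV2.
Qed.

Lemma taylor_qdiff f a c M rho : taylor f a c M rho -> qdiff f a (c 1%N).
Proof.
move=> T; have c0 := taylor0 _ _ _ _ _ T; case: T => M0 r0 fP.
exists (M / rho ^+ 2), rho; split=> //.
  by rewrite divr_ge0// exprn_ge0// ltW.
move=> h hr; have := fP 2%N h isT hr.
rewrite big_ord_recl big_ord1 /= expr0 mulr1 expr1 c0 opprD addrA.
by rewrite expr_div_n mulrA mulrAC.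
Qed.

(** A Cauchy-type estimate: [c n * h ^+ n] is the difference of two consecutive remainders, taken at
    [⟦h⟧ = rho / 2]. *)
Lemma taylor_coef f a c M rho n : taylor f a c M rho -> (1 < n)%N ->
  ⟦c n⟧ <= 2 * M / rho ^+ n.
Proof.
move=> [M0 r0 fP] n1; pose h := (rho / 2)%:C.
have r2 : 0 < rho / 2 by rewrite divr_gt0.
have hE : ⟦h⟧ = rho / 2 by rewrite modulus_real gtr0_norm.
have hr : ⟦h⟧ < rho by rewrite hE; lra.
have H1 := fP n h n1 hr; have H2 := fP n.+1 h (ltnW n1) hr.
have hr' : ⟦h⟧ / rho = 2^-1 by rewrite hE mulrAC divff ?mul1r ?gt_eqF.
rewrite hr' in H1 H2.
have : ⟦c n * h ^+ n⟧ <= M * 2^-1 ^+ n + M * 2^-1 ^+ n.+1.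
  have -> : c n * h ^+ n = (f (a + h) - \sum_(i < n) c i * h ^+ i) -
       (f (a + h) - \sum_(i < n.+1) c i * h ^+ i).
    by rewrite big_ord_recr /=; ring.
  by apply: le_trans (modulusB _ _) _; exact: lerD.
have E : (2 : R)^-1 ^+ n * 2 ^+ n = 1 by rewrite -exprMn mulVf ?expr1n.
rewrite modulusM modulusX hE expr_div_n mulrA ler_pdivrMr ?exprn_gt0//.
rewrite ler_pdivlMr ?exprn_gt0// => /le_trans; apply.
have -> : (M * 2^-1 ^+ n + M * 2^-1 ^+ n.+1) * 2 ^+ n =
    M * (2^-1 ^+ n * 2 ^+ n) * (3 / 2).
  by rewrite exprSr; field.
rewrite E; lra.
Qed.

Lemma exp2_small (M e : R) : 0 < e -> exists N, forall n, (N <= n)%N -> M * 2^-1 ^+ n <= e.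
Proof.
move=> e0; exists (Num.bound (M / e)) => n Nn.
rewrite exprVn ler_pdivrMr ?exprn_gt0// -ler_pdivrMl// mulrC.
apply: le_trans (ler_norm _) _.
apply: le_trans (ltW (archi_boundP _)) _ => //.
have -> : Num.bound `|M / e| = Num.bound (M / e) by rewrite /Num.bound normr_id.
rewrite -natrX ler_nat; apply: leq_trans Nn _.
exact/ltnW/ltn_expl.
Qed.

(** Domination by a sequence that at least halves at each step. Keeping the term [2 * b (N + j)] on
    the right makes the induction telescope. *)
Lemma tail_bound (F : nat -> C) (b : nat -> R) N L : (N <= L)%N ->
  (forall n, (N <= n)%N -> 0 <= b n /\ 2 * b n.+1 <= b n) ->
  (forall n, (N <= n)%N -> ⟦F n⟧ <= b n) ->
  ⟦\sum_(n < L) F n - \sum_(n < N) F n⟧ <= 2 * b N.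
Proof.
move=> NL bP FP.
suff H j : ⟦\sum_(n < N + j) F n - \sum_(n < N) F n⟧ <= 2 * b N - 2 * b (N + j)%N.
  rewrite -(subnKC NL); apply: le_trans (H _) _.
  by have [] := bP (N + (L - N))%N (leq_addr _ _); lra.
elim: j => [|j IH]; first by rewrite addn0 !subrr modulus0.
rewrite addnS big_ord_recr /= addrAC.
apply: le_trans (modulusD _ _) _.
have Nj := leq_addr j N.
by have [_ h1] := bP _ Nj; have h2 := FP _ Nj; lra.
Qed.

Lemma analytic_taylor (f : R[i]^o -> R[i]^o) (a : R[i]^o) : analytic_at f a ->
  exists c M rho, taylor f a c M rho.
Proof.
move=> [c /nearC_modulusP[e [e0 eP]]]; exists c.
have S h : ⟦h⟧ < e -> forall eps, 0 < eps -> exists N, forall n, (N <= n)%N ->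
    ⟦\sum_(i < n) c i * h ^+ i - f (a + h)⟧ < eps.
  move=> he eps eps0.
  have := eP (a + h); rewrite (addrC a) addrK => /(_ he).
  move=> /cvgC_modulus/(_ eps eps0)[N NP]; exists N => n /NP.
  by rewrite /series /= big_mkord addrC.
have [r [r0 re']] : exists r : R, 0 < r /\ r < e by exists (e / 2); lra.
have rE : ⟦r%:C⟧ = r by rewrite modulus_real gtr0_norm.
have re : ⟦r%:C⟧ < e by rewrite rE.
have [B [B0 BP]] : exists B : R, 0 <= B /\ forall n, ⟦c n⟧ * r ^+ n <= B.
  have [N NP] := S _ re 2^-1 ltac:(by rewrite invr_gt0).
  exists (1 + \sum_(i < N) ⟦c i⟧ * r ^+ i).
  have p0 i : 0 <= ⟦c i⟧ * r ^+ i.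
    by rewrite mulr_ge0 ?modulus_ge0// exprn_ge0// ltW.
  split; first by rewrite addr_ge0// sumr_ge0.
  move=> n; have [nN|Nn] := ltnP n N.
    rewrite (bigD1 (Ordinal nN)) //= addrCA lerDl addr_ge0//.
    by apply: sumr_ge0 => i _; exact: p0.
  (* From [N] on, consecutive partial sums are both within 1/2 of the limit, so their difference,
     the [n]-th term, is at most 1. *)
  apply: (@le_trans _ _ 1); last by rewrite lerDl sumr_ge0.
  rewrite -rE -modulusX -modulusM.
  have H1 := NP _ Nn; have H2 := NP _ (leqW Nn).
  have -> : c n * r%:C ^+ n = (\sum_(i < n.+1) c i * r%:C ^+ i - f (a + r%:C))
     - (\sum_(i < n) c i * r%:C ^+ i - f (a + r%:C)).
    by rewrite big_ord_recr /=; ring.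
  by apply: le_trans (modulusB _ _) _; lra.
(* Halving the radius keeps the ratio [⟦h⟧ / r] at most 1/2, so [tail_bound] applies; the factor 2
   is the one it produces. *)
exists (2 * B), (r / 2); split; rewrite ?mulr_ge0 ?divr_gt0//.
move=> N h _ hr; apply/ler_addgt0Pr => eps eps0.
have he : ⟦h⟧ < e by lra.
have [L0 LP] := S h he eps eps0.
pose L := maxn L0 N.
have -> : f (a + h) - \sum_(n < N) c n * h ^+ n =
  (\sum_(n < L) c n * h ^+ n - \sum_(n < N) c n * h ^+ n)
  - (\sum_(n < L) c n * h ^+ n - f (a + h)) by ring.
apply: le_trans (modulusB _ _) _; apply: lerD; last exact/ltW/LP/leq_maxl.
pose q := ⟦h⟧ / r.
have q0 : 0 <= q by rewrite divr_ge0 ?modulus_ge0 ?ltW.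
have q2 : 2 * q <= 1 by rewrite /q mulrA ler_pdivrMr// mul1r; lra.
have step n : 2 * (B * q ^+ n.+1) <= B * q ^+ n.
  have -> : 2 * (B * q ^+ n.+1) = B * q ^+ n * (2 * q) by rewrite exprS; ring.
  by rewrite ler_piMr// mulr_ge0// exprn_ge0.
apply: le_trans (tail_bound (fun n => c n * h ^+ n) (fun n => B * q ^+ n) N L _ _ _) _.
- exact: leq_maxr.
- by move=> n _; rewrite step mulr_ge0// exprn_ge0.
- move=> n _; rewrite modulusM modulusX /q expr_div_n mulrA mulrAC.
  rewrite ler_wpM2r ?exprn_ge0 ?modulus_ge0// ler_pdivlMr ?exprn_gt0//.
- rewrite -mulrA ler_wpM2l// ler_wpM2l// lerXn2r ?nnegrE//.
    by rewrite divr_ge0 ?modulus_ge0// divr_ge0// ltW.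
  by rewrite /q ler_wpM2l ?modulus_ge0// lef_pV2 ?posrE ?divr_gt0//; lra.
Qed.

Lemma taylor_sub_affine f a c M rho (p q : C) : taylor f a c M rho ->
  taylor (fun z => f z - (p + q * (z - a))) a (fun n => c n - nth 0 [:: p; q] n) M rho.
Proof.
move=> [M0 r0 fP]; split=> // N h N1 hr.
have -> : \sum_(n < N) (c n - nth 0 [:: p; q] n) * h ^+ n =
   \sum_(n < N) c n * h ^+ n - (p + q * h); last first.
  have -> : f (a + h) - (p + q * (a + h - a)) - (\sum_(n < N) c n * h ^+ n - (p + q * h)) =
    f (a + h) - \sum_(n < N) c n * h ^+ n by ring.
  exact: fP.
case: N N1 => [//|[//|N] _].
rewrite !big_ord_recl /= /bump /= !expr0 !expr1.
rewrite (eq_bigr (fun i : 'I_N => c (1 + (1 + i))%N * h ^+ (1 + (1 + i)))); last first.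
  by move=> i _; rewrite nth_nil subr0.
ring.
Qed.

(** Dividing by [z] shifts the coefficients, and the remainder of order [N] is that of [f] at order
    [N.+1] divided by [h]. The value [c 1] fills the removable singularity. *)
Lemma taylor_div f c M rho : taylor f 0 c M rho -> c 0%N = 0 ->
  taylor (fun z => if z == 0 then c 1%N else f z / z) 0 (fun n => c n.+1) (M / rho) rho.
Proof.
move=> [M0 r0 fP] c0; have rge0 := ltW r0; split=> //; first by rewrite divr_ge0.
move=> N h N1 hr; rewrite add0r; case: eqVneq => [->|h0].
  case: N N1 => [//|N _].
  rewrite (sum_pow0 (fun n => c n.+1)) subrr modulus0.
  by rewrite mulr_ge0 ?exprn_ge0// divr_ge0// modulus_ge0.
have hp : 0 < ⟦h⟧ by rewrite modulus_gt0.
have := fP N.+1 h (leqW N1) hr.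
rewrite add0r big_ord_recl c0 mul0r add0r.
have -> : \sum_(i < N) c (bump 0 i) * h ^+ bump 0 i = h * \sum_(i < N) c i.+1 * h ^+ i.
  by rewrite mulr_sumr; apply: eq_bigr => i _; rewrite exprS mulrCA.
set s := \sum_(i < N) _.
have -> : f h - h * s = (f h / h - s) * h by field.
rewrite modulusM -ler_pdivlMr// => /le_trans; apply.
rewrite exprS.
have -> // : M * (⟦h⟧ / rho * (⟦h⟧ / rho) ^+ N) / ⟦h⟧ = M / rho * (⟦h⟧ / rho) ^+ N.
by field; rewrite !gt_eqF.
Qed.

Lemma modulus_subXX z w (K : R) n : ⟦z⟧ <= K -> ⟦w⟧ <= K ->
  ⟦z ^+ n - w ^+ n⟧ <= ⟦z - w⟧ * (n%:R * K ^+ n.-1).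
Proof.
move=> zK wK; have K0 : 0 <= K := le_trans (modulus_ge0 _) zK.
rewrite subrXX modulusM ler_wpM2l ?modulus_ge0//.
apply: le_trans (modulus_sum n (fun i => z ^+ (n.-1 - i) * w ^+ i)) _.
have -> : n%:R * K ^+ n.-1 = \sum_(i < n) K ^+ n.-1.
  by rewrite sumr_const card_ord mulr_natl.
apply: ler_sum => i _; rewrite modulusM !modulusX.
have -> : K ^+ n.-1 = K ^+ (n.-1 - i) * K ^+ i.
  rewrite -exprD subnK//; case: n i => [[]//|n [i /= ]]; lia.
by apply: ler_pM; rewrite ?exprn_ge0 ?modulus_ge0// lerXn2r// nnegrE ?modulus_ge0.
Qed.

(** Comparing [f] with a long partial sum reduces the claim to differences of powers, each of which
    contains the factor [k]. The small Lipschitz constant is what allows termwise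
    differentiation. *)
Lemma taylor_remainder_lipschitz f a c M rho N h k (K : R) :
  taylor f a c M rho -> ⟦h⟧ <= K -> ⟦h + k⟧ <= K -> 4 * K <= rho -> (0 < N)%N ->
  ⟦(f (a + (h + k)) - \sum_(n < N.+1) c n * (h + k) ^+ n) -
    (f (a + h) - \sum_(n < N.+1) c n * h ^+ n)⟧ <=
  4 * M / rho * (2 * K / rho) ^+ N * ⟦k⟧.
Proof.
move=> T hK hkK Kr N0; have [M0 r0 fP] := T.
have K0 : 0 <= K := le_trans (modulus_ge0 _) hK.
apply/ler_addgt0Pr => e e0.
have [L0 LP] := exp2_small (2 * M) e e0.
pose L := maxn L0 N.+1.
pose G n := c n * ((h + k) ^+ n - h ^+ n).
have SG n : \sum_(i < n) G i = \sum_(i < n) c i * (h + k) ^+ i - \sum_(i < n) c i * h ^+ i.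
  by rewrite -sumrB; apply: eq_bigr => i _; rewrite /G mulrBr.
have rem w : ⟦w⟧ <= K -> ⟦f (a + w) - \sum_(n < L) c n * w ^+ n⟧ <= M * 2^-1 ^+ L.
  move=> wK; have := fP L w; rewrite !leq_max /= ltnS N0 orbT => /(_ isT).
  have wr : ⟦w⟧ < rho by lra.
  move=> /(_ wr) /le_trans; apply; rewrite ler_wpM2l// lerXn2r ?nnegrE//.
  - by rewrite divr_ge0 ?modulus_ge0 ?ltW.
  - by rewrite ler_pdivrMr//; lra.
have -> : (f (a + (h + k)) - \sum_(n < N.+1) c n * (h + k) ^+ n) -
    (f (a + h) - \sum_(n < N.+1) c n * h ^+ n) =
  (\sum_(n < L) G n - \sum_(n < N.+1) G n) +
  ((f (a + (h + k)) - \sum_(n < L) c n * (h + k) ^+ n) -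
    (f (a + h) - \sum_(n < L) c n * h ^+ n)).
  by rewrite !SG; ring.
apply: le_trans (modulusD _ _) _; apply: lerD; last first.
  apply: le_trans (modulusB _ _) _; apply: le_trans (LP L (leq_maxl _ _)).
  by rewrite -mulrA mulr_natl mulr2n lerD// rem.
pose q := 2 * K / rho.
have q0 : 0 <= q by rewrite divr_ge0 ?mulr_ge0// ltW.
have q2 : 2 * q <= 1 by rewrite /q mulrA ler_pdivrMr//; lra.
(* The difference of [n.+1]-st powers costs a factor [n.+1 <= 2 ^+ n]; it is absorbed by the 2 in
   [q = 2 * K / rho]. *)
pose b n := ⟦k⟧ * (2 * M / rho) * q ^+ n.-1.
have A0 : 0 <= ⟦k⟧ * (2 * M / rho).
  by rewrite mulr_ge0 ?modulus_ge0// divr_ge0 ?mulr_ge0// ltW.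
have -> : 4 * M / rho * (2 * K / rho) ^+ N * ⟦k⟧ = 2 * b N.+1.
  by rewrite /b /= /q; ring.
apply: tail_bound; first exact: leq_maxr.
  case=> // n _; rewrite /b /= mulr_ge0 ?exprn_ge0//; split=> //.
  have -> : 2 * (⟦k⟧ * (2 * M / rho) * q ^+ n.+1) =
     ⟦k⟧ * (2 * M / rho) * q ^+ n * (2 * q) by rewrite exprS; ring.
  by rewrite ler_piMr// mulr_ge0// exprn_ge0.
case=> // n; rewrite ltnS => Nn; rewrite /G /b /= modulusM.
have n1 : (1 < n.+1)%N by rewrite ltnS (leq_trans N0).
have H1 := taylor_coef _ _ _ _ _ _ T n1.
have H2 := modulus_subXX _ _ _ n.+1 hkK hK.
rewrite addrAC subrr add0r /= in H2.
have H3 : (n.+1%:R : R) <= 2 ^+ n by rewrite -natrX ler_nat ltn_expl.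
apply: le_trans (ler_pM (modulus_ge0 _) (modulus_ge0 _) H1 H2) _.
have -> : 2 * M / rho ^+ n.+1 * (⟦k⟧ * (n.+1%:R * K ^+ n)) =
   ⟦k⟧ * (2 * M / rho) * (n.+1%:R * (K / rho) ^+ n).
  by rewrite expr_div_n exprS invfM; ring.
have -> : q = 2 * (K / rho) by rewrite /q; ring.
by rewrite ler_wpM2l// [leRHS]exprMn ler_wpM2r// exprn_ge0// divr_ge0// ltW.
Qed.

(** Termwise differentiation: the new remainder is the derivative at [a + h] of [f] minus its
    partial sum of length [N.+1], and is bounded by the Lipschitz constant of that difference. *)
Lemma taylor_deriv f (F : C -> C) a c M rho : taylor f a c M rho ->
  (forall h, ⟦h⟧ < rho -> qdiff f (a + h) (F (a + h))) ->
  taylor F a (fun n => n.+1%:R * c n.+1) (4 * M / rho) (rho / 4).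
Proof.
move=> T fF; have [M0 r0 _] := T.
split; first by rewrite divr_ge0 ?mulr_ge0// ltW.
  by rewrite divr_gt0.
move=> N h N1 hr.
(* At the centre the increments considered below would have to be smaller than 0. The claim there is
   [F a = c 1], which is uniqueness of the derivative. *)
have [->|h0] := eqVneq h 0.
  case: N N1 => // N _.
  rewrite (sum_pow0 (fun n => n.+1%:R * c n.+1)) mul1r.
  have fa : qdiff f a (F (a + 0)).
    by rewrite -[X in qdiff _ X _]addr0; apply: fF; rewrite modulus0.
  rewrite (qdiff_inj _ _ _ _ fa (taylor_qdiff _ _ _ _ _ T)).
  by rewrite subrr modulus0 mul0r expr0n mulr0.
have hp : 0 < ⟦h⟧ by rewrite modulus_gt0.
have qE : qdiff (fun z => f (a + z) + \sum_(n < N.+1) (- c n) * z ^+ n) h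
    (F (a + h) + \sum_(n < N.+1) (- c n) * (n%:R * h ^+ n.-1)).
  apply: qdiffD; first by apply: qdiff_shift; apply: fF; lra.
  apply: (qdiff_sum (fun n z => - c n * z ^+ n) (fun n => - c n * (n%:R * h ^+ n.-1))) => i.
  exact/qdiffZ/qdiffX.
have -> : F (a + h) - \sum_(n < N) n.+1%:R * c n.+1 * h ^+ n =
   F (a + h) + \sum_(n < N.+1) (- c n) * (n%:R * h ^+ n.-1).
  rewrite big_ord_recl mul0r mulr0 add0r -sumrN; congr (_ + _).
  by apply: eq_bigr => i _ /=; rewrite /bump /= add1n; ring.
(* With [K = ⟦h⟧ + ⟦k⟧], the first bound on [⟦k⟧] gives [2 * K / rho <= ⟦h⟧ / (rho / 4)] and the
   second gives [4 * K <= rho]. *)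
apply: (qdiff_lipschitz _ _ _ _ (Num.min ⟦h⟧ (rho / 4 - ⟦h⟧)) qE).
  by rewrite lt_min hp subr_gt0.
move=> k; rewrite lt_min => /andP[k1 k2].
have S z : \sum_(n < N.+1) - c n * z ^+ n = - \sum_(n < N.+1) c n * z ^+ n.
  by rewrite -sumrN; apply: eq_bigr => i _; rewrite mulNr.
rewrite !S.
apply: le_trans (taylor_remainder_lipschitz _ _ _ _ _ N h k (⟦h⟧ + ⟦k⟧) T _ _ _ _) _.
- by rewrite lerDl modulus_ge0.
- exact: modulusD.
- by lra.
- exact: ltnW.
rewrite ler_wpM2r ?modulus_ge0// ler_wpM2l//.
  by rewrite divr_ge0 ?mulr_ge0// ltW.
have n0 := modulus_ge0 k.
rewrite lerXn2r ?nnegrE//.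
- by rewrite divr_ge0 ?mulr_ge0 ?addr_ge0// ltW.
- by rewrite !divr_ge0 ?modulus_ge0// ltW.
have -> : ⟦h⟧ / (rho / 4) = 4 * ⟦h⟧ / rho by field; rewrite gt_eqF.
by rewrite ler_pM2r ?invr_gt0//; lra.
Qed.

Lemma le0_of_linear_bound (x L r : R) : 0 < r -> 0 <= L ->
  (forall t, 0 < t -> t < r -> x <= L * t) -> x <= 0.
Proof.
move=> r0 L0 H; apply/ler_addgt0Pr => e e0; rewrite add0r.
pose t := Num.min (r / 2) (e / (L + 1)).
have L1 : 0 < L + 1 by lra.
have t0 : 0 < t by rewrite lt_min !divr_gt0.
have tr : t < r by rewrite gt_min; apply/orP; left; lra.
apply: le_trans (H t t0 tr) _.
have : t <= e / (L + 1) by rewrite ge_min lexx orbT.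
rewrite ler_pdivlMr//; lra.
Qed.

(** * Maximum principle *)

(* If [c m] is the first nonzero coefficient of [V] and [zeta ^+ m = alpha / c m], then
   along [h = t * zeta] the perturbation [V h] is close to [t ^ m (alpha + beta * h)]. *)
Lemma locally_max_perturbation (V : C -> C) c M rho (alpha beta : C) (r : R) :
  taylor V 0 c M rho -> V 0 = 0 -> alpha != 0 -> 0 < r ->
  (forall h, ⟦h⟧ < r -> ⟦alpha + beta * h + V h⟧ <= ⟦alpha + beta * h⟧) ->
  forall h, ⟦h⟧ < rho / 2 -> V h = 0.
Proof.
move=> T V0 al0 r0 Vmax h hrho; have [M0 rho0 VP] := T.
have c0 : c 0%N = 0 by rewrite (taylor0 _ _ _ _ _ T).
(* If all coefficients vanish, the remainder bounds [M * (⟦h⟧ / rho) ^+ N] tend to 0 with ratio at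
   most 1/2, whence [V h = 0]. Otherwise a contradiction is derived. *)
have [cP|] := pselect (forall n, c n = 0).
  have hr : ⟦h⟧ < rho by lra.
  apply/eqP; rewrite -modulus_eq0 eq_le modulus_ge0 andbT.
  apply/ler_addgt0Pr => e e0; rewrite add0r.
  have [N NP] := exp2_small M e e0.
  have := VP (maxn 2 N) h; rewrite leq_maxl => /(_ isT hr).
  rewrite add0r big1 => [|i _]; last by rewrite cP mul0r.
  rewrite subr0 => /le_trans; apply; apply: le_trans (NP _ (leq_maxr 2 N)).
  rewrite ler_wpM2l// lerXn2r ?nnegrE//.
  - by rewrite divr_ge0 ?modulus_ge0 ?ltW.
  - by rewrite ler_pdivrMr//; lra.
move=> /existsNP[n0 /eqP cn0].
have ex : exists n, c n != 0 by exists n0.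
have [m cm mmin] := ex_minnP ex.
have m0 : (0 < m)%N by case: m cm {mmin} => //; rewrite c0 eqxx.
exfalso.
pose zeta := m.-root (alpha / c m).
have zE : zeta ^+ m = alpha / c m by rewrite /zeta rootCK.
have z0 : zeta != 0.
  apply/eqP => z0; move: zE; rewrite z0 expr0n gtn_eqF//= => /esym/eqP.
  by rewrite mulf_eq0 invr_eq0 (negPf al0) (negPf cm).
have zp : 0 < ⟦zeta⟧ by rewrite modulus_gt0.
pose L := ⟦beta * zeta⟧ + M * (⟦zeta⟧ / rho) ^+ m.+1.
have L0 : 0 <= L.
  by rewrite addr_ge0 ?modulus_ge0// mulr_ge0// exprn_ge0// divr_ge0// ?modulus_ge0// ltW.
suff : ⟦alpha⟧ <= 0 by rewrite leNgt modulus_gt0 al0.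
apply: (le0_of_linear_bound _ (L + ⟦beta * zeta⟧) (Num.min 1 (Num.min r rho / ⟦zeta⟧))).
- by rewrite !lt_min ltr01 divr_gt0// lt_min r0.
- by rewrite addr_ge0 ?modulus_ge0.
move=> t t0; rewrite !lt_min ltr_pdivlMr// lt_min => /andP[t1 /andP[tr trho]].
have tE : ⟦t%:C⟧ = t by rewrite modulus_real gtr0_norm.
pose h1 := t%:C * zeta.
have h1E : ⟦h1⟧ = t * ⟦zeta⟧ by rewrite modulusM tE.
have H := Vmax h1; rewrite h1E in H; have {}H := H tr.
have := VP m.+1 h1 m0; rewrite h1E add0r => /(_ trho).
rewrite big_ord_recr /= big1 => [|[i /= im] _]; last first.
  have [->|ci] := eqVneq (c i) 0; first by rewrite mul0r.
  by have := mmin _ ci; rewrite leqNgt im.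
rewrite add0r => HE.
pose A := alpha + beta * h1; set E := V h1 - _ in HE.
(* Up to order [m.+1] in [t], adding [V h1] multiplies [A] by [1 + t ^+ m]. Since
   [⟦A + V h1⟧ <= ⟦A⟧], this forces [⟦A⟧ <= L * t], although [A] tends to [alpha != 0]. *)
have AE : A * (1 + t%:C ^+ m) = (A + V h1) + (beta * zeta * t%:C ^+ m.+1 - E).
  have e : c m * h1 ^+ m = alpha * t%:C ^+ m.
    by rewrite exprMn zE; field.
  by rewrite /E e /A /h1 exprS; ring.
have t0' := ltW t0.
have HA : ⟦A⟧ * (1 + t ^+ m) <= ⟦A⟧ + L * t ^+ m.+1.
  have -> : 1 + t ^+ m = ⟦1 + t%:C ^+ m⟧.
    have -> : 1 + t%:C ^+ m = (1 + t ^+ m)%:C by rewrite rmorphD rmorph1 rmorphXn.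
    by rewrite modulus_real ger0_norm// addr_ge0// exprn_ge0.
  rewrite -modulusM AE; apply: le_trans (modulusD _ _) _; apply: lerD => //.
  apply: le_trans (modulusB _ _) _; rewrite modulusM modulusX tE /L mulrDl.
  apply: lerD => //; apply: le_trans HE _.
  have -> // : M * (t * ⟦zeta⟧ / rho) ^+ m.+1 = M * (⟦zeta⟧ / rho) ^+ m.+1 * t ^+ m.+1.
  by rewrite -!mulrA exprMn; ring.
have tm : 0 < t ^+ m by rewrite exprn_gt0.
have {}HA : ⟦A⟧ <= L * t.
  rewrite -(ler_pM2r tm); move: HA; rewrite exprS; lra.
have -> : alpha = A - beta * zeta * t%:C by rewrite /A /h1; ring.
apply: le_trans (modulusB _ _) _; rewrite [⟦_ * t%:C⟧]modulusM tE; lra.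
Qed.

(** * Maxima of continuous functions on closed disks *)

Definition cont_on (K : C -> Prop) (phi : C -> R) := forall z, K z ->
  forall e, 0 < e -> exists d : R, 0 < d /\
    forall w, K w -> ⟦w - z⟧ < d -> `|phi w - phi z| < e.

(** Identifying [R[i]] with [R * R] turns [K] into a closed subset of a compact square, to which the
    extreme value theorem applies. *)
Lemma closed_bounded_max (K : C -> Prop) (phi : C -> R) (r : R) :
  (exists z, K z) -> (forall z, K z -> ⟦z⟧ <= r) ->
  (forall z, ~ K z -> exists d : R, 0 < d /\ forall w, ⟦w - z⟧ < d -> ~ K w) ->
  cont_on K phi -> exists a, K a /\ forall z, K z -> phi z <= phi a.
Proof.
move=> [z0 Kz0] Kr Kcl phic.
pose emb (p : R * R) : C := p.1 +i* p.2.
have embK z : emb (complex.Re z, complex.Im z) = z by case: z.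
have nearE (p : R * R) (d : R) : 0 < d -> \forall q \near p, ⟦emb q - emb p⟧ < d.
  move=> d0; have d2 : 0 < d / 2 by rewrite divr_gt0.
  apply/nbhs_ballP; exists (d / 2) => //= q [/= b1 b2].
  change (⟦emb q - emb p⟧ < d).
  have -> : emb q - emb p = (q.1 - p.1)%:C + 'i%C * (q.2 - p.2)%:C.
    by rewrite [LHS]complexE.
  apply: le_lt_trans (modulusD _ _) _; rewrite modulusM !modulus_real.
  have -> : ⟦'i%C : C⟧ = 1.
    by apply/eqP; rewrite -sqrp_eq1 ?modulus_ge0// modulus_sqr /= expr0n add0r expr1n.
  move: b1 b2; rewrite /ball /= distrC => b1; rewrite distrC => b2; lra.
pose A : set (R * R) := fun p => K (emb p).
have cA : compact A.
  apply: (@subclosed_compact _ _ (`[- r, r] `*` `[- r, r])%classic).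
  - move=> p clA; apply: contrapT => /Kcl[d [d0 dP]].
    by have [q [Aq /dP]] := clA _ (nearE p d d0).
  - by apply: compact_setX; exact: segment_compact.
  - move=> [x y] /Kr K1; have H : ⟦x +i* y⟧ <= r := K1.
    have r0 : 0 <= r := le_trans (modulus_ge0 _) H.
    have {}H : ⟦x +i* y⟧ ^+ 2 <= r ^+ 2.
      by rewrite lerXn2r ?nnegrE ?modulus_ge0.
    rewrite modulus_sqr /= in H.
    split; rewrite /= in_itv /= -ler_norml -(ler_pXn2r (ltn0Sn 1)) ?nnegrE//
      real_normK ?num_real//.
      by have := sqr_ge0 y; lra.
    by have := sqr_ge0 x; lra.
have cphi : {within A, continuous (phi \o emb)}%classic.
  apply/subspace_continuousP => p Ap.
  apply/cvgrPdist_lt => e e0.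
  have [d [d0 dP]] := phic _ Ap e e0.
  rewrite near_withinE; apply: filterS (nearE p d d0) => q qp Aq /=.
  by rewrite distrC; exact: dP.
have A0 : (A !=set0)%classic by exists (complex.Re z0, complex.Im z0); rewrite /A /= embK.
have [c cA' cmax] := compact_EVT_max A0 cA cphi.
exists (emb c); split; first by rewrite inE in cA'.
move=> z Kz; rewrite -(embK z); apply: cmax.
by rewrite inE /A /= embK.
Qed.

(** A superlevel set of a continuous function on a closed disk is closed. The choice [psi = - ⟦z⟧]
    later yields a point of least modulus. *)
Lemma disk_superlevel_max (phi psi : C -> R) (r b : R) :
  cont_on (fun z => ⟦z⟧ <= r) phi -> cont_on (fun z => ⟦z⟧ <= r) psi ->
  (exists z, ⟦z⟧ <= r /\ b <= phi z) ->
  exists a, [/\ ⟦a⟧ <= r, b <= phi a &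
    forall z, ⟦z⟧ <= r -> b <= phi z -> psi z <= psi a].
Proof.
move=> phic psic ex.
have [] := closed_bounded_max (fun z => ⟦z⟧ <= r /\ b <= phi z) psi r ex.
- by move=> z [].
- move=> z; have [zr|zr _] := leP ⟦z⟧ r; last first.
    exists (⟦z⟧ - r); rewrite subr_gt0; split=> // w wz [wr _].
    have : ⟦z⟧ <= ⟦w⟧ + ⟦w - z⟧.
      by rewrite -[X in ⟦X⟧ <= _](subKr w) modulusB.
    lra.
  move=> Kz; have zb : 0 < b - phi z.
    by rewrite subr_gt0 ltNge; apply/negP => zb; exact: Kz.
  have [d [d0 dP]] := phic z zr _ zb.
  exists d; split=> // w wz [wr bw]; have := dP w wr wz.
  rewrite ltNge => /negP; apply; apply: le_trans (ler_norm _).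
  by rewrite lerD2r.
- move=> z [zr _] e e0; have [d [d0 dP]] := psic z zr e e0.
  by exists d; split=> // w [wr _]; exact: dP.
by move=> a [[ar ab] amax]; exists a; split=> // z zr zb; exact: amax.
Qed.

(** Two successive maximizations: first of [phi], above its value at 0, then of [psi] on the set
    where [phi] reaches its maximum. *)
Lemma disk_lex_max (phi psi : C -> R) (r : R) : 0 <= r ->
  cont_on (fun z => ⟦z⟧ <= r) phi -> cont_on (fun z => ⟦z⟧ <= r) psi ->
  exists a, ⟦a⟧ <= r /\
    forall z, ⟦z⟧ <= r -> phi z <= phi a /\ (phi z = phi a -> psi z <= psi a).
Proof.
move=> r0 phic psic.
have [|b [br b0 bmax]] := disk_superlevel_max phi phi r (phi 0) phic phic.
  by exists 0; rewrite modulus0.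
have {b0}bmax z : ⟦z⟧ <= r -> phi z <= phi b.
  by move=> zr; have [/ltW z0|/bmax->//] := ltP (phi z) (phi 0); exact: le_trans b0.
have [|a [ar ab amax]] := disk_superlevel_max phi psi r (phi b) phic psic.
  by exists b.
exists a; split=> // z zr; split; first exact: le_trans (bmax _ zr) ab.
by move=> za; apply: amax; rewrite // za.
Qed.

Lemma taylor_eq f g a b c M rho : taylor f a c M rho ->
  (forall h, ⟦h⟧ < rho -> g (b + h) = f (a + h)) -> taylor g b c M rho.
Proof. by move=> [M0 r0 fP] fg; split=> // N h N1 hr; rewrite fg// fP. Qed.

Lemma modulus_dist z w : `|⟦z⟧ - ⟦w⟧| <= ⟦z - w⟧.
Proof.
have H1 := modulusD (z - w) w; have H2 := modulusB z (z - w).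
rewrite subrK in H1; rewrite subKr in H2.
by rewrite ler_norml; lra.
Qed.

(** Only increments from the fixed point [a] are compared. This weak form still gives continuity of
    the modulus and survives division by [z] away from 0. *)
Definition locally_lipschitz g a := exists L r : R, [/\ 0 <= L, 0 < r &
  forall h, ⟦h⟧ < r -> ⟦g (a + h) - g a⟧ <= L * ⟦h⟧].

Lemma qdiff_locally_lipschitz g a d : qdiff g a d -> locally_lipschitz g a.
Proof.
move=> [B [r [B0 r0 gP]]]; exists (B * r + ⟦d⟧), r.
split; rewrite ?addr_ge0 ?modulus_ge0 ?mulr_ge0// ?ltW// => h hr.
have -> : g (a + h) - g a = (g (a + h) - g a - d * h) + d * h by ring.
apply: le_trans (modulusD _ _) _; rewrite mulrDl modulusM lerD2r.
apply: le_trans (gP h hr) _; rewrite expr2 mulrA ler_wpM2r ?modulus_ge0//.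
by rewrite ler_wpM2l// ltW.
Qed.

Lemma locally_lipschitz_div g a : locally_lipschitz g a -> a != 0 ->
  locally_lipschitz (fun z => g z / z) a.
Proof.
move=> [L [r [L0 r0 gP]]] a0; have ap : 0 < ⟦a⟧ by rewrite modulus_gt0.
exists ((L * ⟦a⟧ + ⟦g a⟧) / (⟦a⟧ ^+ 2 / 2)), (Num.min r (⟦a⟧ / 2)); split.
- by rewrite divr_ge0 ?divr_ge0 ?addr_ge0 ?mulr_ge0 ?exprn_ge0 ?modulus_ge0.
- by rewrite lt_min r0 divr_gt0.
move=> h; rewrite lt_min => /andP[hr ha].
have H : ⟦a⟧ / 2 <= ⟦a + h⟧.
  have := modulusB (a + h) h; rewrite addrK; lra.
have ah0 : a + h != 0 by rewrite -modulus_gt0; lra.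
have -> : g (a + h) / (a + h) - g a / a =
    ((g (a + h) - g a) * a - g a * h) / (a * (a + h)).
  by field; rewrite a0 ah0.
rewrite modulusM modulusV modulusM mulrAC ler_pM ?invr_ge0 ?mulr_ge0 ?modulus_ge0//.
  apply: le_trans (modulusB _ _) _; rewrite !modulusM mulrDl lerD2r mulrAC.
  by rewrite ler_wpM2r ?modulus_ge0// gP.
rewrite lef_pV2 ?posrE ?divr_gt0 ?exprn_gt0 ?mulr_gt0 ?modulus_gt0//.
by rewrite expr2 -mulrA ler_wpM2l// modulus_ge0.
Qed.

Lemma locally_lipschitz_cont (K : C -> Prop) g :
  (forall z, K z -> locally_lipschitz g z) -> cont_on K (fun z => ⟦g z⟧).
Proof.
move=> gK z /gK[L [r [L0 r0 gP]]] e e0.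
have L1 : 0 < L + 1 by lra.
exists (Num.min r (e / (L + 1))); rewrite lt_min r0 divr_gt0//; split=> // w _.
rewrite lt_min ltr_pdivlMr// => /andP[wr we].
apply: le_lt_trans (modulus_dist _ _) _.
have := gP (w - z) wr; rewrite (addrC z) subrK; have := modulus_ge0 (w - z); nra.
Qed.

(** * Schwarz' and Jack's lemmas *)

Lemma schwarz g (r : R) : 0 < r ->
  (forall a, ⟦a⟧ <= r -> exists c M rho, taylor g a c M rho) ->
  g 0 = 0 -> (forall z, ⟦z⟧ <= r -> ⟦g z⟧ <= 1) ->
  forall z, ⟦z⟧ <= r -> ⟦g z⟧ * r <= ⟦z⟧.
Proof.
move=> r0 gT g0 g1.
have [c [M [rho T]]] : exists c M rho, taylor g 0 c M rho.
  by apply: gT; rewrite modulus0 ltW.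
have c0 : c 0%N = 0 by rewrite (taylor0 _ _ _ _ _ T).
pose q z := if z == 0 then c 1%N else g z / z.
have Tq : taylor q 0 (fun n => c n.+1) (M / rho) rho := taylor_div _ _ _ _ T c0.
have qE z : z != 0 -> q z = g z / z by rewrite /q => /negPf ->.
have gq z : g z = q z * z.
  by have [->|z0] := eqVneq z 0; rewrite ?g0 ?mulr0// qE// divfK.
have qlip z : ⟦z⟧ <= r -> locally_lipschitz q z.
  move=> zr; have [->|z0] := eqVneq z 0.
    exact: qdiff_locally_lipschitz (taylor_qdiff _ _ _ _ _ Tq).
  have [c' [M' [rho' T']]] := gT z zr.
  have [L [s [L0 s0 H]]] :=
    locally_lipschitz_div _ _ (qdiff_locally_lipschitz _ _ _ (taylor_qdiff _ _ _ _ _ T')) z0.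
  exists L, (Num.min s ⟦z⟧); split=> //; first by rewrite lt_min s0 modulus_gt0.
  move=> h; rewrite lt_min => /andP[hs hz]; rewrite !qE//; first exact: H.
  apply: contraTneq hz => /eqP; rewrite addr_eq0 => /eqP ->.
  by rewrite modulusN ltxx.
have [a [ar amax]] : exists a, ⟦a⟧ <= r /\ forall z, ⟦z⟧ <= r ->
    ⟦q z⟧ <= ⟦q a⟧ /\ (⟦q z⟧ = ⟦q a⟧ -> ⟦z⟧ <= ⟦a⟧).
  apply: disk_lex_max; [exact: ltW|exact: locally_lipschitz_cont|].
  apply: (locally_lipschitz_cont _ id) => z _; exists 1, 1; split=> // h _.
  by rewrite addrC addKr mul1r.
suff qa : ⟦q a⟧ * r <= 1.
  move=> z zr; rewrite gq modulusM mulrAC.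
  rewrite -[leRHS]mul1r ler_wpM2r ?modulus_ge0//; apply: le_trans qa.
  by rewrite ler_pM2r//; have [] := amax z zr.
(* On the boundary circle the bound [⟦g a⟧ <= 1] is already the claim. In the interior, a nonzero
   [q a] would make [q] locally constant, so a point slightly further out would also be a
   maximizer. *)
have [are|/negP anr] := boolP (r <= ⟦a⟧).
  have aE : ⟦a⟧ = r by apply/le_anti; rewrite ar are.
  by have := g1 a ar; rewrite gq modulusM aE.
have {ar anr}ar : ⟦a⟧ < r by rewrite ltNge; apply/negP.
have [->|qa0] := eqVneq (q a) 0; first by rewrite modulus0 mul0r.
exfalso.
suff [s [s0 sP]] : exists s : R, 0 < s /\ forall h, ⟦h⟧ < s -> q (a + h) = q a.
  pose t := Num.min s (r - ⟦a⟧) / 2.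
  have m0 : 0 < Num.min s (r - ⟦a⟧) by rewrite lt_min s0 subr_gt0.
  have t0 : 0 < t by rewrite divr_gt0.
  have : t < Num.min s (r - ⟦a⟧) by rewrite /t; lra.
  rewrite lt_min => /andP[ts tr].
  have [h [hE ahE]] : exists h, ⟦h⟧ = t /\ ⟦a + h⟧ = ⟦a⟧ + t.
    have [->|a0] := eqVneq a 0.
      by exists t%:C; rewrite add0r modulus0 add0r modulus_real gtr0_norm.
    have ap : 0 < ⟦a⟧ by rewrite modulus_gt0.
    exists ((t / ⟦a⟧)%:C * a); split.
      by rewrite modulusM modulus_real gtr0_norm ?divr_gt0// divfK ?gt_eqF.
    have -> : a + (t / ⟦a⟧)%:C * a = (1 + t / ⟦a⟧)%:C * a by rewrite rmorphD rmorph1; ring.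
    rewrite modulusM modulus_real gtr0_norm ?addr_gt0 ?divr_gt0// mulrDl mul1r.
    by rewrite divfK ?gt_eqF.
  have hr : ⟦a + h⟧ <= r by rewrite ahE; lra.
  have [_] := amax _ hr; rewrite sP ?hE// => /(_ erefl); rewrite ahE; lra.
(* At the origin the perturbation lemma is applied to [q] itself, with [alpha = q 0] and
   [beta = 0]. *)
have [a0|a0] := eqVneq a 0.
  have T0 := taylor_sub_affine _ _ _ _ _ (q 0) 0 Tq.
  have rho0 : 0 < rho by case: Tq.
  exists (rho / 2); split=> [|h hr]; first by rewrite divr_gt0.
  rewrite a0 add0r; apply/eqP; rewrite -subr_eq0; apply/eqP.
  rewrite a0 in qa0 amax.
  apply: (locally_max_perturbation (fun z => q z - q 0) _ _ _ (q 0) 0 r _ _ qa0 r0) hr.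
  - by apply: taylor_eq T0 _ => k _; rewrite mul0r addr0.
  - by rewrite subrr.
  - move=> k kr; rewrite mul0r addr0 addrC subrK.
    by have [] := amax k (ltW kr).
(* Elsewhere it is applied to [g], compared with the affine map [g a + q a * h = q a * (a + h)]:
   maximality of [⟦q a⟧] says exactly that [⟦g (a + h)⟧] is at most the modulus of that map. *)
have [c' [M' [rho' T']]] := gT a (ltW ar).
have T0 := taylor_sub_affine _ _ _ _ _ (g a) (q a) T'.
have rho0 : 0 < rho' by case: T'.
have ap : 0 < ⟦a⟧ by rewrite modulus_gt0.
have nz h : ⟦h⟧ < ⟦a⟧ -> a + h != 0.
  by apply: contraTneq => /eqP; rewrite addr_eq0 => /eqP ->; rewrite modulusN ltxx.
exists (Num.min (rho' / 2) ⟦a⟧); split=> [|h]; first by rewrite lt_min ap divr_gt0.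
rewrite lt_min => /andP[hrho ha].
have : g (a + h) - (g a + q a * h) = 0.
  apply: (locally_max_perturbation (fun z => g (a + z) - (g a + q a * z))
    _ _ _ (g a) (q a) (r - ⟦a⟧) _ _ _ _ _ _ hrho).
  - by apply: taylor_eq T0 _ => k _; rewrite add0r (addrC a) addrK.
  - by rewrite addr0 mulr0 addr0 subrr.
  - by rewrite gq mulf_neq0.
  - by rewrite subr_gt0.
  - move=> k kr; have akr : ⟦a + k⟧ <= r by apply: le_trans (modulusD _ _) _; lra.
    rewrite addrC subrK [g a]gq -mulrDr gq !modulusM ler_wpM2r ?modulus_ge0//.
    by have [] := amax _ akr.
move/eqP; rewrite subr_eq0 [g a]gq -mulrDr gq => /eqP.
by apply: mulIf; exact: nz.
Qed.

Lemma jack g z0 d : 0 < ⟦z0⟧ ->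
  (forall z, ⟦z⟧ <= ⟦z0⟧ -> ⟦g z⟧ * ⟦z0⟧ <= ⟦z⟧) ->
  ⟦g z0⟧ = 1 -> qdiff g z0 d ->
  exists k : R, 1 <= k /\ z0 * d = k%:C * g z0.
Proof.
move=> z0p gS g1 [B [e [B0 e0 gP]]].
have w0 : g z0 != 0 by rewrite -modulus_gt0 g1.
pose kappa := z0 * d / g z0.
have kE : z0 * d = kappa * g z0 by rewrite /kappa divfK.
(* For [zeta = - t (1 + i s)], the real part of [kappa * zeta] is [- t (Re kappa - s Im kappa)],
   while [⟦1 + zeta⟧] is at most [1 - t] up to order [t ^+ 2], whatever [s] is. *)
have key s : 1 <= complex.Re kappa - s * complex.Im kappa.
  set X := _ - _; pose S := 1 + s ^+ 2.
  have S0 : 0 < S by have := sqr_ge0 s; rewrite /S; lra.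
  rewrite -subr_le0.
  pose v : C := 1 +i* s.
  have v2 : ⟦v⟧ ^+ 2 = S by rewrite modulus_sqr /= expr1n.
  have vp : 0 < ⟦v⟧.
    by rewrite lt_def modulus_ge0 andbT -sqrf_eq0 v2 gt_eqF.
  apply: (le0_of_linear_bound _ (S / 2 + B * (S * ⟦z0⟧ ^+ 2))
    (Num.min (1 / S) (e / (⟦v⟧ * ⟦z0⟧)))).
  - by rewrite lt_min !divr_gt0// mulr_gt0.
  - by rewrite addr_ge0 ?divr_ge0 ?mulr_ge0 ?exprn_ge0// ltW.
  move=> t t0; rewrite lt_min ltr_pdivlMr// ltr_pdivlMr ?mulr_gt0// => /andP[tS te].
  pose zeta := - (t%:C * v).
  have tE : ⟦t%:C⟧ = t by rewrite modulus_real gtr0_norm.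
  have hE : ⟦z0 * zeta⟧ = t * (⟦v⟧ * ⟦z0⟧) by rewrite modulusM modulusN modulusM tE; ring.
  have H2 : ⟦1 + zeta⟧ ^+ 2 = 1 - 2 * t + t ^+ 2 * S.
    by rewrite modulus_sqr /S /=; ring.
  have H1 : ⟦1 + zeta⟧ <= 1.
    rewrite -(ler_pXn2r (ltn0Sn 1)) ?nnegrE ?modulus_ge0// H2 expr1n.
    by rewrite expr2 -mulrA; nra.
  (* The inequality [x <= (1 + x ^+ 2) / 2] replaces an expansion of the square root. *)
  have H3 : ⟦1 + zeta⟧ <= 1 - t + t ^+ 2 * S / 2.
    by have := sqr_ge0 (1 - ⟦1 + zeta⟧); rewrite sqrrB H2; lra.
  have z0E : z0 + z0 * zeta = z0 * (1 + zeta) by ring.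
  have H4 : ⟦g (z0 + z0 * zeta)⟧ <= ⟦1 + zeta⟧.
    rewrite -(ler_pM2r z0p); apply: le_trans (gS _ _) _; rewrite z0E modulusM.
      by rewrite ler_piMr// ltW.
    by rewrite mulrC.
  have := gP (z0 * zeta); rewrite hE => /(_ te) H5.
  have H6 : ⟦1 + kappa * zeta⟧ <= ⟦1 + zeta⟧ + B * (t * (⟦v⟧ * ⟦z0⟧)) ^+ 2.
    have -> : ⟦1 + kappa * zeta⟧ = ⟦g z0 + d * (z0 * zeta)⟧.
      have -> : g z0 + d * (z0 * zeta) = g z0 * (1 + kappa * zeta).
        by rewrite mulrA (mulrC d) kE; ring.
      by rewrite modulusM g1 mul1r.
    have -> : g z0 + d * (z0 * zeta) = g (z0 + z0 * zeta) -
      (g (z0 + z0 * zeta) - g z0 - d * (z0 * zeta)) by ring.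
    by apply: le_trans (modulusB _ _) _; exact: lerD.
  have H7 : 1 - t * X <= ⟦1 + kappa * zeta⟧.
    apply: le_trans (Re_le_modulus _).
    rewrite /zeta /v /X; case: (kappa) => x y /=.
    by rewrite le_eqVlt; apply/orP; left; apply/eqP; ring.
  rewrite !exprMn v2 in H6.
  rewrite -(ler_pM2l t0).
  have -> : t * ((S / 2 + B * (S * ⟦z0⟧ ^+ 2)) * t) =
      t ^+ 2 * S / 2 + B * (t ^+ 2 * (S * ⟦z0⟧ ^+ 2)).
    by field.
  lra.
(* Were the imaginary part nonzero, [s = Re kappa / Im kappa] would turn [key] into [1 <= 0]. *)
have Im0 : complex.Im kappa = 0.
  apply/eqP/negPn/negP => i0.
  have := key (complex.Re kappa / complex.Im kappa).
  by rewrite divfK// subrr ler10.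
have Re1 : 1 <= complex.Re kappa by have := key 0; rewrite mul0r subr0.
exists (complex.Re kappa); split=> //.
by rewrite kE; congr (_ * _); rewrite [LHS]complexE Im0 mulr0 addr0.
Qed.

Lemma first_unit_modulus g z1 :
  (forall a, ⟦a⟧ < 1 -> exists c M rho, taylor g a c M rho) ->
  g 0 = 0 -> ⟦z1⟧ < 1 -> 1 <= ⟦g z1⟧ ->
  exists z0, [/\ 0 < ⟦z0⟧, ⟦z0⟧ < 1, ⟦g z0⟧ = 1 &
    forall z, ⟦z⟧ <= ⟦z0⟧ -> ⟦g z⟧ <= 1].
Proof.
move=> gT g0 z1lt g1.
have glip z : ⟦z⟧ < 1 -> locally_lipschitz g z.
  by move=> /gT[c [M [rho /taylor_qdiff/qdiff_locally_lipschitz]]].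
have [|||z0 [z0r gz0 z0min]] :=
    disk_superlevel_max (fun z => ⟦g z⟧) (fun z => - ⟦z⟧) ⟦z1⟧ 1.
- by apply: locally_lipschitz_cont => z zr; apply: glip; exact: le_lt_trans z1lt.
- move=> z _ e e0; exists e; split=> // w _; apply: le_lt_trans.
  by rewrite -opprD normrN modulus_dist.
- by exists z1.
have z0lt : ⟦z0⟧ < 1 := le_lt_trans z0r z1lt.
have z0p : 0 < ⟦z0⟧.
  rewrite modulus_gt0; apply/eqP => z00.
  by move: gz0; rewrite z00 g0 modulus0 ler10.
have inside z : ⟦z⟧ < ⟦z0⟧ -> ⟦g z⟧ < 1.
  move=> zz0; rewrite ltNge; apply/negP => /z0min.
  by rewrite lerN2 (le_trans (ltW zz0))// => /(_ isT); rewrite leNgt zz0.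
(* Minimality of [⟦z0⟧] controls only the open disk; the bounding circle is approached along the
   radius through [z]. At [z0] this gives [⟦g z0⟧ = 1]. *)
have closed z : ⟦z⟧ <= ⟦z0⟧ -> ⟦g z⟧ <= 1.
  move=> zz0; have [L [s [L0 s0 gL]]] := glip z (le_lt_trans zz0 z0lt).
  rewrite -subr_le0.
  apply: (le0_of_linear_bound _ (L * ⟦z0⟧) (Num.min 1 (s / ⟦z0⟧))).
  - by rewrite lt_min ltr01 divr_gt0.
  - by rewrite mulr_ge0// ltW.
  move=> t t0; rewrite lt_min ltr_pdivlMr// => /andP[t1 ts].
  have tE : ⟦- t%:C * z⟧ = t * ⟦z⟧.
    by rewrite modulusM modulusN modulus_real gtr0_norm.
  have tz : t * ⟦z⟧ <= t * ⟦z0⟧ by rewrite ler_pM2l.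
  have := gL (- t%:C * z); rewrite tE => /(_ (le_lt_trans tz ts)) H.
  have in1 : ⟦g (z + - t%:C * z)⟧ < 1.
    apply: inside; have -> : z + - t%:C * z = (1 - t)%:C * z.
      by rewrite rmorphB rmorph1; ring.
    rewrite modulusM modulus_real gtr0_norm ?subr_gt0//.
    apply: le_lt_trans (_ : (1 - t) * ⟦z0⟧ < _); last by nra.
    by rewrite ler_wpM2l// subr_ge0 ltW.
  have := modulus_dist (g (z + - t%:C * z)) (g z); rewrite ler_norml => /andP[H1 _].
  have : L * (t * ⟦z⟧) <= L * (t * ⟦z0⟧) by rewrite ler_wpM2l.
  lra.
exists z0; split=> //; apply/le_anti; rewrite gz0 andbT; exact: closed.
Qed.

(** * Derivatives on the unit disk and tools for the final contradiction *)

(** Hypothesis and conclusion have the same shape, so the lemma can be applied to [f] and then to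
    [derive1 f]. The radius is shrunk to keep [a + h] in the unit disk. *)
Lemma taylor_derive1 (f : R[i]^o -> R[i]^o) :
  (forall a, ⟦a⟧ < 1 -> exists c M rho, taylor f a c M rho) ->
  forall a, ⟦a⟧ < 1 ->
    qdiff f a (derive1 f a) /\ exists c M rho, taylor (derive1 f) a c M rho.
Proof.
move=> fT.
have fq a : ⟦a⟧ < 1 -> qdiff f a (derive1 f a).
  by move=> /fT[c [M [rho /taylor_qdiff fa]]]; rewrite (derive1_qdiff f a _ fa).
move=> a a1; split; first exact: fq.
have [c [M [rho T]]] := fT a a1.
have rho0 : 0 < rho by case: T.
have r0 : 0 < Num.min rho (1 - ⟦a⟧) by rewrite lt_min rho0 subr_gt0.
have {}T := taylor_shrink _ _ _ _ _ _ T r0 ltac:(by rewrite ge_min lexx).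
do 3 eexists; apply: (taylor_deriv _ _ _ _ _ _ T) => h.
rewrite lt_min => /andP[_ ha]; apply: fq.
by apply: le_lt_trans (modulusD _ _) _; lra.
Qed.

(** The Möbius map [w / (1 + w)] sends the unit circle without -1 to a vertical line. *)
Lemma Re_unit_modulus w : ⟦w⟧ = 1 -> 1 + w != 0 -> complex.Re (w / (1 + w)) = 1 / 2.
Proof.
move=> w1 w0.
suff: forall u, u * (1 + w) = w -> complex.Re u = 1 / 2 by apply; rewrite divfK.
have := modulus_sqr w; rewrite w1 expr1n.
case: w w0 {w1} => x y w0 /= xy [p q] pq /=.
have x0 : 1 + x != 0.
  apply: contraNneq w0 => x0; have xE : x = -1 by lra.
  have /eqP : y ^+ 2 = 0 by move: xy; rewrite xE sqrrN expr1n; lra.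
  by rewrite sqrf_eq0 => /eqP ->; rewrite eq_complex /= xE addr0 subrr eqxx.
have /= E1 := congr1 (@complex.Re R) pq; have /= E2 := congr1 (@complex.Im R) pq.
have yE : y ^+ 2 = 1 - x ^+ 2 by lra.
(* Real part of [u * (1 + w)] times the conjugate of [1 + w]; on the circle, the squared modulus of
   [1 + w] is [2 * (1 + x)]. *)
have e : p * ((1 + x) ^+ 2 + y ^+ 2) =
    (1 + x) * (p * (1 + x) - q * (0 + y)) + y * (p * (0 + y) + q * (1 + x)) by ring.
have {E1 E2}e : (1 + x) * (2 * p) = (1 + x) * 1.
  by move: e; rewrite E1 E2 -expr2 yE; lra.
by have := mulfI x0 e; lra.
Qed.

Lemma near0_small (L e : R) : 0 <= L -> 0 < e -> \forall t \near (0^'+)%classic, L * t < e.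
Proof.
move=> L0 e0; have L1 : 0 < L + 1 by lra.
near=> t; have t0 : 0 < t by near: t; exact: nbhs_right_gt.
have : t < e / (L + 1) by near: t; apply: nbhs_right_lt; rewrite divr_gt0.
by rewrite ltr_pdivlMr//; lra.
Unshelve. all: by end_near. Qed.

(** Continuity at 1 holds for exponents of either sign. The constant 1/2 is offset by the factor 2
    built into [Q] in the theorem. *)
Lemma powR_near1 (beta : R) : exists e : R, 0 < e /\
  forall y, `|y - 1| < e -> 1 / 2 < y `^ beta.
Proof.
have : {for 1, continuous (fun y : R => y `^ beta)}.
  apply/differentiable_continuous/derivable1_diffP/derivable_powR.
  by rewrite in_itv /= ltr01.
move=> /cvgrPdist_lt/(_ (1 / 2) ltac:(by rewrite divr_gt0)).
move=> /nbhs_ballP[e /= e0 eP]; exists e; split=> // y y1.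
have := eP y; rewrite /ball /= distrC powR1 => /(_ y1).
rewrite ltr_norml; lra.
Qed.

(* At a zero [z0] of [F] the logarithmic derivative has a pole, so that it beats any bound. *)
Lemma pole_bound (F F' : C -> C) z0 (e Q : R) : 0 < ⟦z0⟧ -> 0 < e -> F z0 = 0 ->
  qdiff F z0 (F' z0) -> F' z0 != 0 -> locally_lipschitz F' z0 ->
  exists h, [/\ ⟦h⟧ < e, ⟦F (z0 + h)⟧ < e &
    Q <= ⟦(z0 + h) * F' (z0 + h) / F (z0 + h)⟧].
Proof.
move=> z0p e0 F0 qF d0 [L2 [r2 [L20 r20 F'P]]].
have [L [r [L0 r0 FL]]] := qdiff_locally_lipschitz _ _ _ qF.
have [B [s [B0 s0 FB]]] := qF.
set d := F' z0 in d0 F'P FB *.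
have dp : 0 < ⟦d⟧ by rewrite modulus_gt0.
near ((0 : R)^'+)%classic => t.
have t0 : 0 < t by near: t; exact: nbhs_right_gt.
have te : t < e by near: t; exact: nbhs_right_lt.
have tr : t < r by near: t; exact: nbhs_right_lt.
have ts : t < s by near: t; exact: nbhs_right_lt.
have tr2 : t < r2 by near: t; exact: nbhs_right_lt.
have tz : t < ⟦z0⟧ / 2 by near: t; apply: nbhs_right_lt; rewrite divr_gt0.
have tL : L * t < e by near: t; exact: near0_small.
have tB : B * t < ⟦d⟧ by near: t; exact: near0_small.
have tL2 : L2 * t < ⟦d⟧ / 2 by near: t; apply: near0_small; rewrite // divr_gt0.
(* The numerator has modulus at least [⟦z0⟧ / 2 * (⟦d⟧ / 2)] and the denominator at most [L * t], so
   this is what makes the quotient exceed [Q]. *)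
have tQ : L * `|Q| * t < ⟦z0⟧ / 2 * (⟦d⟧ / 2).
  by near: t; apply: near0_small; rewrite ?mulr_ge0// mulr_gt0// divr_gt0.
have tE : ⟦t%:C⟧ = t by rewrite modulus_real gtr0_norm.
have HL := FL t%:C; have HB := FB t%:C; have H2 := F'P t%:C.
rewrite tE F0 ?subr0 in HL HB H2.
have {}HL := HL tr; have {}HB := HB ts; have {}H2 := H2 tr2.
exists t%:C; rewrite tE; split=> //; first exact: le_lt_trans HL tL.
set z := z0 + _ in HL HB H2 *.
have zp : ⟦z0⟧ / 2 <= ⟦z⟧.
  by have := modulusB z t%:C; rewrite /z addrK tE; lra.
have F'p : ⟦d⟧ / 2 <= ⟦F' z⟧.
  by have := modulusB (F' z) (F' z - d); rewrite subKr; lra.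
(* The linear term [d * t] dominates the error [B * t ^+ 2]. Nonvanishing matters because of the
   convention [w / 0 = 0]. *)
have Fp : 0 < ⟦F z⟧.
  have := modulusB (F z) (F z - d * t%:C); rewrite subKr modulusM tE.
  by move: HB; rewrite expr2; nra.
rewrite modulusM modulusV modulusM ler_pdivlMr//.
apply: (@le_trans _ _ (`|Q| * ⟦F z⟧)).
  by rewrite ler_wpM2r ?ler_norm// ltW.
apply: (@le_trans _ _ (`|Q| * (L * t))); first by rewrite ler_wpM2l.
apply: (@le_trans _ _ (⟦z0⟧ / 2 * (⟦d⟧ / 2))); first by lra.
by apply: ler_pM => //; rewrite divr_ge0// ltW.
Unshelve. all: by end_near. Qed.

Lemma Re_affine (x y : R) w :
  complex.Re (x%:C + y%:C * w) = x + y * complex.Re w.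
Proof. by case: w => p q /=; rewrite mul0r subr0. Qed.

Lemma powR_modulus1 z (b : R) : ⟦z⟧ = 1 -> ⟦z⟧ `^ b = 1.
Proof. by move=> ->; rewrite powR1. Qed.

End Jack.

Theorem theorem1 (R : realType) (f : R[i]^o -> R[i]^o) (beta gamma delta : R)
  (hf : classA f) (hgamma : 0 <= gamma) (hdelta : - (1 / 2) < delta)
  (hineq : forall z : R[i]^o, unit_disk z ->
     modulus (derive1 f z - 1) `^ beta *
     modulus (delta%:C + z * derive1 (derive1 f) z / derive1 f z) `^ gamma
       < ((1 + 2 * delta) / 2) `^ gamma) :
  classC f.
Proof.
have T0 : 0 < (1 + 2 * delta) / 2 by lra.
have Tk k : 1 <= k -> (1 + 2 * delta) / 2 <= delta + k * (1 / 2) by lra.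
split=> // z1 z1lt; have [fan f0 f'0] := hf.
have diskE (z : R[i]^o) : unit_disk z <-> modulus z < 1.
  by rewrite /unit_disk /= normC_modulus ltcR.
rewrite normC_modulus ltcR ltNge; apply/negP => gz1; move/diskE: z1lt => z1lt.
have fT a : modulus a < 1 -> exists c M rho, taylor f a c M rho.
  by move=> a1; apply/analytic_taylor/fan/diskE.
set F := derive1 f in f'0 hineq gz1.
have FT a : modulus a < 1 -> exists c M rho, taylor F a c M rho.
  by move=> a1; have [] := taylor_derive1 f fT a a1.
pose g (z : R[i]) : R[i] := F z - 1.
have gT a : modulus a < 1 -> exists c M rho, taylor g a c M rho.
  move=> /FT[c [M [rho T]]]; do 3 eexists.
  by apply: taylor_eq (taylor_sub_affine _ _ _ _ _ 1 0 T) _ => h _; rewrite mul0r addr0.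
have g0 : g 0 = 0 by rewrite /g f'0 subrr.
have [z0 [z0p z0lt gz0 gle1]] := first_unit_modulus g z1 gT g0 z1lt gz1.
have Fq a : modulus a < 1 -> qdiff F a (derive1 F a).
  by move=> a1; have [] := taylor_derive1 F FT a a1.
have gq : qdiff g z0 (derive1 F z0).
  have [B [e [B0 e0 FP]]] := Fq z0 z0lt; exists B, e; split=> // h he.
  have -> : g (z0 + h) - g z0 - derive1 F z0 * h =
    F (z0 + h) - F z0 - derive1 F z0 * h by rewrite /g opprB addrA subrK.
  exact: FP.
have gTr a : modulus a <= modulus z0 -> exists c M rho, taylor g a c M rho.
  by move=> az0; apply: gT; exact: le_lt_trans z0lt.
have [k [k1 kE]] := jack _ _ _ z0p (schwarz _ _ z0p gTr g0 gle1) gz0 gq.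
have FE z : F z = 1 + g z by rewrite /g addrC subrK.
have [Fz0|Fz0] := eqVneq (F z0) 0; last first.
  have := hineq z0; rewrite (powR_modulus1 _ _ gz0) mul1r => /(_ (proj2 (diskE _) z0lt)).
  rewrite ltNge => /negP; apply.
  apply: ge0_ler_powR; rewrite ?nnegrE ?modulus_ge0 ?(ltW T0)//.
  apply: le_trans (Re_le_modulus _).
  have -> : delta%:C + z0 * derive1 F z0 / F z0 = delta%:C + k%:C * (g z0 / F z0).
    by rewrite kE mulrA.
  have : complex.Re (g z0 / F z0) = 1 / 2.
    by rewrite FE; apply: Re_unit_modulus => //; rewrite -FE.
  by rewrite Re_affine => ->; exact: Tk.
(* For [gamma = 0] both powers with this exponent are 1, even at the pole, and the hypothesis at
   [z0] reads [1 < 1]. *)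
have [gamma0|gammaN0] := eqVneq gamma 0.
  have := hineq z0; rewrite (powR_modulus1 _ _ gz0) mul1r gamma0 !powRr0.
  by move=> /(_ (proj2 (diskE _) z0lt)); rewrite ltxx.
have gamma_gt0 : 0 < gamma by rewrite lt_def gammaN0.
(* Jack's lemma with [k >= 1] makes the zero of [F] at [z0] simple. *)
have F'z0 : derive1 F z0 != 0.
  apply/eqP => d0; move/eqP: kE; rewrite d0 mulr0 eq_sym mulf_eq0.
  by rewrite -!modulus_eq0 gz0 oner_eq0 orbF modulus_real gt_eqF//
    normr_gt0 gt_eqF// (lt_le_trans ltr01).
have F'lip : locally_lipschitz (derive1 F) z0.
  have F'T a : modulus a < 1 -> exists c M rho, taylor (derive1 F) a c M rho.
    by move=> a1; have [] := taylor_derive1 F FT a a1.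
  by have [c [M [rho /taylor_qdiff/qdiff_locally_lipschitz]]] := F'T z0 z0lt.
have [e [e0 eP]] := powR_near1 beta.
(* Chosen so that [Q] to the power [gamma] is twice the right-hand side of the hypothesis. *)
pose Q := (1 + 2 * delta) / 2 * 2 `^ gamma^-1.
have Q0 : 0 <= Q by rewrite mulr_ge0 ?powR_ge0// ltW.
have QE : Q `^ gamma = ((1 + 2 * delta) / 2) `^ gamma * 2.
  by rewrite [LHS]powRM ?powR_ge0 ?(ltW T0)// -powRrM mulVf// powRr1.
have m0 : 0 < Num.min e (1 - modulus z0) by rewrite lt_min e0 subr_gt0.
(* The summand [|delta|] pays for adding [delta] to the quotient. The radius keeps [z0 + h] in the
   disk and, as [F] is small there, [⟦F - 1⟧] close to 1. *)
have [h [he Fe hQ]] := pole_bound F (derive1 F) z0 _ (Q + `|delta|) z0p m0 Fz0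
  (Fq z0 z0lt) F'z0 F'lip.
move: he Fe; rewrite !lt_min => /andP[_ hz] /andP[Fe _].
have zlt : modulus (z0 + h) < 1.
  by apply: le_lt_trans (modulusD _ _) _; rewrite -ltrBrDl.
have := hineq (z0 + h) (proj2 (diskE _) zlt).
set Y := modulus (delta%:C + _).
have YQ : Q <= Y.
  have := modulusB (delta%:C + (z0 + h) * derive1 F (z0 + h) / F (z0 + h)) delta%:C.
  rewrite (addrC delta%:C) addrK modulus_real (addrC _ delta%:C) -/Y => H.
  by rewrite -(lerD2r `|delta|); exact: le_trans hQ H.
have YQg : Q `^ gamma <= Y `^ gamma.
  by apply: ge0_ler_powR; rewrite ?nnegrE ?modulus_ge0.
have g2 : 1 / 2 < modulus (F (z0 + h) - 1) `^ beta.
  apply: eP; have := modulus_dist (F (z0 + h) - 1) (- 1).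
  by rewrite modulusN modulus1 opprK subrK => /le_lt_trans; apply.
rewrite ltNge => /negP; apply.
apply: le_trans (_ : 1 / 2 * Q `^ gamma <= _); last first.
  by apply: ler_pM; rewrite ?powR_ge0 ?divr_ge0 ?(ltW g2).
by rewrite QE mulrCA div1r mulVf ?mulr1.
Qed.
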